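(* Let $f\colon X\to Y$ be a stratified map between stratified spaces. Then $\sigma\mapsto f\circ\sigma$ sends filtered simplices of $X$ to filtered simplices of $Y$ and defines a chain map $f_*\colon C_*^{\mathcal F}(X)\to C_*^{\mathcal F}(Y)$. Moreover, for every filtered simplex $\sigma$ of $X$ and every $\ell\ge0$, $$\|f_*(\sigma)\|_\ell\le\|\sigma\|_\ell.$$
   Context: A filtered space is a topological space $X$ with a filtration by closed subspaces $X_0\subseteq X_1\subseteq\dots\subseteq X_n=X$ with $X_n\setminus X_{n-1}\neq\emptyset$; $n=d(X)$ is its formal dimension; by convention $X_j=\emptyset$ for $j<0$ and $X_j=X$ for $j>n$. The strata are the non-empty connected components $S$ of the $X_i\setminus X_{i-1}$, and $d(S)=i$; $\mathcal S_X$ is the set of strata. A stratified space is a filtered space such that any two strata $S,S'$ with $S\cap\overline{S'}\ne\emptyset$ satisfy $S\subset\overline{S'}$. A stratified map $f\colon(X,(X_j)_{0\le j\le n})\to(Y,(Y_j)_{0\le j\le m})$ is a continuous map between stratified spaces such that for every $S\in\mathcal S_X$ there is $S^f\in\mathcal S_Y$ with $f(S)\subset S^f$ and $m-d(S^f)\le n-d(S)$. A filtered simplex of $X$ is a continuous map $\sigma\colon\Delta\to X$ from a euclidean simplex (with ordered vertices) such that for each $i\in\{0,\dots,n\}$, $\sigma^{-1}(X_i)$ is empty or a face $[0,1,\dots,m_i]$ of $\Delta$ spanned by the first vertices. $C_*^{\mathcal F}(X)$ is the subcomplex of the singular chain complex (coefficients in a commutative ring $R$) generated by filtered simplices. The perverse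 degree of a filtered simplex $\sigma$ of $X$ is $\|\sigma\|_\ell=\dim\sigma^{-1}(X_{n-\ell})$, with $\|\sigma\|_\ell=-\infty$ if $\sigma^{-1}(X_{n-\ell})=\emptyset$ (where $n$ is the formal dimension of the target of $\sigma$). *)

(* Defs.v *)
From HB Require Import structures.
From mathcomp Require Import all_boot all_order all_algebra finmap.
From mathcomp Require Import boolp classical_sets functions reals.
From mathcomp Require Import constructive_ereal ereal topology normedtype.
(* The notations of [monalg] clash with those of MathComp-Analysis. *)
From mathcomp Require Import -(notations) monalg.
From mathcomp Require Import zify.
Import numFieldNormedType.Exports.

Set Implicit Arguments.
Unset Strict Implicit.
Unset Printing Implicit Defensive.

Import Order.TTheory GRing.Theory Num.Theory.
Local Open Scope classical_set_scope.
Local Open Scope ring_scope.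

(* The filtration is indexed by [int], so that the conventions X_j = set0 for
   j < 0 and X_j = X for j > n are part of the structure. *)
Record filtered_space := FilteredSpace {
  carrier :> topologicalType;
  fdim : nat;
  skel : int -> set carrier;
  skel_closed : forall j, closed (skel j);
  skel_subset : forall j, skel j `<=` skel (j + 1);
  skel_neg : forall j, j < 0 -> skel j = set0;
  skel_top : forall j, fdim%:Z <= j -> skel j = setT;
  skel_fdim : (skel fdim%:Z `\` skel (fdim%:Z - 1)) !=set0
}.

(* [stratum i S] says that S is a stratum of X with d(S) = i.  As S is nonempty,
   it determines i, and 0 <= i <= fdim X. *)
Definition stratum (X : filtered_space) (i : int) (S : set X) : Prop :=
  exists2 x, (skel i `\` skel (i - 1)) x
           & S = connected_component (skel i `\` skel (i - 1)) x.

Definition stratified (X : filtered_space) : Prop :=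
  forall (i i' : int) (S S' : set X), stratum i S -> stratum i' S' ->
    S `&` closure S' !=set0 -> S `<=` closure S'.

Definition stratified_map (X Y : filtered_space) (f : continuousType X Y) :
    Prop :=
  forall (i : int) (S : set X), stratum i S ->
    exists (j : int) (Sf : set Y),
      [/\ stratum j Sf, f @` S `<=` Sf
        & (fdim Y)%:Z - j <= (fdim X)%:Z - i].

Section Simplex.
Variable R : realType.

Definition stdsimplex k : set 'rV[R]_k.+1 :=
  [set x | (forall i, 0 <= x 0 i) /\ \sum_i x 0 i = 1].
Arguments stdsimplex k : clear implicits.

(* The face [0, 1, ..., m] spanned by the first m + 1 vertices. *)
Definition front_face k m : set (stdsimplex k) :=
  [set x : stdsimplex k | forall i : 'I_k.+1, (m < i)%N -> (val x) 0 i = 0].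
Arguments front_face k m : clear implicits.

(* The largest q such that A contains q + 1 affinely independent points, i.e.
   the dimension of the affine hull of A; it is -oo if A is empty (affdim0) and
   m on the face [0, 1, ..., m] (affdim_front_face). *)
Definition affdim d (A : set 'rV[R]_d) : \bar R :=
  ereal_sup [set q%:R%:E | q in [set q : nat |
    exists p : 'I_q.+1 -> 'rV[R]_d, (forall i, A (p i)) /\
      row_free (\matrix_(i < q) (p (lift ord0 i) - p ord0))]].

(* The affine map sending the vertex e_i to e_(t i). *)
Definition simplex_map_mx a b (t : 'I_a.+1 -> 'I_b.+1) (x : 'rV[R]_a.+1) :
  'rV[R]_b.+1 := \row_j \sum_(i | t i == j) x 0 i.

Lemma simplex_map_mxP a b (t : 'I_a.+1 -> 'I_b.+1) (x : stdsimplex a) :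
  simplex_map_mx t (val x) \in stdsimplex b.
Proof.
case: x => x /=; rewrite !inE /= => -[x0 x1].
split=> [j|]; first by rewrite mxE sumr_ge0.
rewrite -[RHS]x1 (partition_big t xpredT) //=.
by apply: eq_bigr => j _; rewrite mxE.
Qed.

Definition simplex_map a b (t : 'I_a.+1 -> 'I_b.+1) (x : stdsimplex a) :
  stdsimplex b := exist (fun y => y \in stdsimplex b) _ (simplex_map_mxP t x).

Lemma continuous_rV (T : topologicalType) d (g : T -> 'rV[R]_d) :
  (forall j, continuous (fun x => g x 0 j)) -> continuous g.
Proof.
move=> gc x A [P nP sP]; rewrite nbhs_simpl /=.
have: \forall y \near x, forall j, P 0 j (g y 0 j).
  by apply: filter_forall => j; exact: (gc j x _ (nP 0 j)).
apply: filterS => y Py; apply: sP => i j; rewrite (ord1 i); exact: Py.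
Qed.

Lemma simplex_map_continuous a b (t : 'I_a.+1 -> 'I_b.+1) :
  continuous (@simplex_map a b t).
Proof.
apply: continuous_comp_initial; apply: continuous_rV => j.
have -> : (fun x : stdsimplex a => (set_val \o @simplex_map a b t) x 0 j) =
          (fun x : stdsimplex a => \sum_(i | t i == j) (val x) 0 i).
  by apply/funext => y; rewrite /= mxE.
apply: continuous_big => [|i _ x]; first exact: add_continuous.
apply: (@continuous_comp _ _ _ set_val (fun y : 'rV[R]_a.+1 => y 0 i)).
  exact: initial_continuous.
exact: coord_continuous.
Qed.

HB.instance Definition _ a b (t : 'I_a.+1 -> 'I_b.+1) :=
  isContinuous.Build _ _ (simplex_map t) (@simplex_map_continuous a b t).

Lemma simplex_map_comp a b c (t : 'I_a.+1 -> 'I_b.+1) (u : 'I_b.+1 -> 'I_c.+1) x :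
  simplex_map u (simplex_map t x) = simplex_map (u \o t) x.
Proof.
apply/val_inj/rowP => j /=; rewrite !mxE.
rewrite [RHS](partition_big t (fun i => u i == j)) //=.
apply: eq_bigr => i /eqP ui; rewrite mxE; apply: eq_bigl => l.
by case: eqVneq => [->|]; rewrite ?ui ?eqxx ?andbF.
Qed.

Lemma affdim0 d : affdim (set0 : set 'rV[R]_d) = -oo%E.
Proof.
rewrite /affdim (_ : [set q | _] = set0) ?image_set0 ?ereal_sup0 //.
by apply/seteqP; split => // q [p [/(_ ord0)]].
Qed.

Lemma affdim_front_face k m : (m <= k)%N ->
  affdim [set val x | x in front_face k m] = m%:R%:E.
Proof.
move=> mk; pose Q : 'M[R]_(k.+1, m) := \matrix_(i, j) (i == j.+1 :> nat)%:R.
have rQ q (M : 'M[R]_(q, k.+1)) i (j : 'I_m) :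
    (M *m Q) i j = M i (inord j.+1).
  rewrite mxE (bigD1 (inord j.+1)) //= mxE inordK ?ltnS ?(leq_trans _ mk) //.
  rewrite eqxx mulr1 big1 ?addr0 // => l lj; rewrite mxE; case: eqP => [e|]; last by rewrite mulr0.
  by case/eqP: lj; apply/val_inj; rewrite /= inordK ?e ?ltnS ?(leq_trans _ mk).
apply/eqP; rewrite eq_le; apply/andP; split.
- apply: ge_ereal_sup => _ [q [p [Ap fp]] <-]; rewrite lee_fin ler_nat.
  set M := \matrix_(i < q) _ in fp.
  have MQ : row_free (M *m Q).
    apply/row_freeP; case/row_freeP: fp => N MN.
    pose T : 'M[R]_(m, k.+1) :=
      \matrix_(j, i) ((i == inord j.+1)%:R - (i == ord0)%:R).
    have TE j i : T j i = (i == inord j.+1)%:R - (i == ord0)%:R by rewrite mxE.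
    exists (T *m N); rewrite -MN mulmxA; congr (_ *m _).
    apply/matrixP => i l; rewrite mxE.
    have M0 (l' : 'I_k.+1) : (m < l')%N -> M i l' = 0.
      move=> ml; rewrite mxE !mxE; have [x xF <-] := Ap (lift ord0 i).
      by have [y yF <-] := Ap ord0; rewrite xF // yF // subrr.
    have sM : \sum_l' M i l' = 0.
      under eq_bigr do rewrite !mxE.
      rewrite sumrB; have [x _ <-] := Ap (lift ord0 i); have [y _ <-] := Ap ord0.
      case: x y => [x xs] [y ys] /=; move: xs ys; rewrite !inE /= => -[_ ->] [_ ->].
      exact: subrr.
    under eq_bigr do rewrite rQ TE.
    have [l0|l0] := eqVneq l ord0.
      rewrite l0.
      rewrite (eq_bigr (fun j : 'I_m => - M i (inord j.+1))); last first.
        move=> j _; rewrite -val_eqE /= inordK ?ltnS ?(leq_trans _ mk) //=.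
        by rewrite sub0r mulrN1.
      rewrite sumrN; apply/eqP; rewrite eqr_oppLR -addr_eq0 addrC; apply/eqP.
      rewrite -[RHS]sM big_ord_recl; congr (_ + _).
      rewrite [RHS](bigID (fun j : 'I_k => (j < m)%N)) /= [X in _ + X]big1 ?addr0.
        rewrite (big_ord_widen_cond k xpredT
                  (fun j => M i (inord j.+1)) mk).
        apply: eq_bigr => j _; congr (M i _); apply/val_inj.
        by rewrite /= inordK //= ltnS.
      by move=> j; rewrite -leqNgt => mj; apply: M0.
    rewrite (eq_bigr (fun j : 'I_m => M i (inord j.+1) *
                        (l == inord j.+1)%:R)); last first.
      by move=> j _; rewrite subr0.
    have [lm|lm] := leqP l m; last first.
      rewrite M0 // big1 // => j _; case: eqP => [e|]; last by rewrite mulr0.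
      by move: lm; rewrite e inordK ?ltnS ?(leq_trans _ mk) // leqNgt ltn_ord.
    have lgt0 : (0 < l)%N by rewrite lt0n.
    have lm' : (l.-1 < m)%N by rewrite prednK.
    rewrite (bigD1 (Ordinal lm')) //= prednK // inord_val eqxx mulr1.
    rewrite big1 ?addr0 // => j jl; case: eqP => [e|]; last by rewrite mulr0.
    case/eqP: jl; apply/val_inj; rewrite /= e inordK ?ltnS ?(leq_trans _ mk) //.
  by rewrite -(eqP MQ) rank_leq_col.
- apply: ereal_sup_ubound; exists m => //.
  exists (fun j => delta_mx 0 (inord j)); split=> [j|].
    have dP : delta_mx 0 (inord j) \in stdsimplex k.
      rewrite inE; split=> [i|]; first by rewrite mxE ler0n.
      rewrite (bigD1 (inord j)) //= mxE !eqxx big1 ?addr0 // => i ij.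
      by rewrite mxE (negPf ij) andbF.
    exists (exist (fun y => y \in stdsimplex k) _ dP) => //= i mi.
    rewrite mxE; case: (i =P inord j) => [ei|_]; last by rewrite andbF.
    move: mi; rewrite ei inordK ?(leq_trans (ltn_ord j)) //.
    by rewrite ltnNge -ltnS ltn_ord.
  apply/row_freeP; exists Q; apply/matrixP => i j; rewrite rQ !mxE.
  rewrite -!val_eqE /= !inordK ?ltnS ?(leq_trans _ mk) //.
  by rewrite eqSS /= subr0 eq_sym.
Qed.

End Simplex.

Record chain_complex (A : comNzRingType) := ChainComplex {
  cobj :> nat -> lmodType A;
  cbd : forall k, {linear cobj k.+1 -> cobj k};
  cbd_cbd : forall k (c : cobj k.+2), cbd k (cbd k.+1 c) = 0
}.

Record chain_map (A : comNzRingType) (C D : chain_complex A) := ChainMap {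
  cmap :> forall k, {linear C k -> D k};
  cmap_cbd : forall k (c : C k.+1), cmap k (cbd C k c) = cbd D k (cmap k.+1 c)
}.

Section LinearExtension.
Variables (A : comNzRingType) (B : choiceType) (V : lmodType A) (h : B -> V).

Definition lin_ext (c : malg B A) : V :=
  \sum_(b <- msupp c) mcoeff b c *: h b.

Lemma lin_extEw (d : {fset B}) c : (msupp c `<=` d)%fset ->
  lin_ext c = \sum_(b <- d) mcoeff b c *: h b.
Proof.
move=> cd; rewrite /lin_ext; apply: big_fset_incl => // b _ bc.
by rewrite mcoeff_outdom ?scale0r.
Qed.

Lemma lin_ext_is_linear : linear lin_ext.
Proof.
move=> a c1 c2; pose d := (msupp c1 `|` msupp c2)%fset.
rewrite !(@lin_extEw d) ?fsubsetUl ?fsubsetUr //; last first.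
  apply: fsubset_trans (msuppD_le _ _) _; apply: fsetUSS => //.
  exact: msuppZ_le.
rewrite scaler_sumr -big_split /=; apply: eq_bigr => b _.
by rewrite mcoeffD mcoeffZ scalerDl scalerA.
Qed.

HB.instance Definition _ :=
  GRing.isLinear.Build A (malg B A) V *:%R lin_ext lin_ext_is_linear.

Lemma lin_extU b : lin_ext (mkmalgU b 1) = h b.
Proof.
rewrite (@lin_extEw [fset b]%fset) ?msuppU_le //.
by rewrite big_seq_fset1 mcoeffUU scale1r.
Qed.

End LinearExtension.

Lemma malgUE (A : comNzRingType) (B : choiceType) (a : A) (b : B) :
  mkmalgU b a = a *: mkmalgU b 1.
Proof.
by apply/malgP => b'; rewrite mcoeffZ !mcoeffU; case: eqP; rewrite ?mulr1 ?mulr0.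
Qed.

Lemma malg_linear_ext (A : comNzRingType) (B : choiceType) (V : lmodType A)
    (F G : {linear malg B A -> V}) :
  (forall b, F (mkmalgU b 1) = G (mkmalgU b 1)) -> F =1 G.
Proof.
move=> FG c; rewrite (monalgE c) !linear_sum; apply: eq_bigr => b _.
by rewrite malgUE !linearZ /= FG.
Qed.

Arguments stdsimplex R k : clear implicits.
Arguments front_face R k m : clear implicits.

Notation singular R k X := (continuousType (stdsimplex R k) X).

Section Singular.
Variables (R : realType) (A : comNzRingType) (X : topologicalType).

Definition face k (i : 'I_k.+2) (s : singular R k.+1 X) : singular R k X :=
  s \o simplex_map (lift i).

Notation chains k := (malg (singular R k X) A).

Definition bd_simplex k (s : singular R k.+1 X) : chains k :=
  \sum_(i < k.+2) (-1) ^+ i *: mkmalgU (face i s) 1.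

Definition singular_bd k : {linear chains k.+1 -> chains k} :=
  lin_ext (@bd_simplex k).

Lemma face_face k (i : 'I_k.+3) (j : 'I_k.+2) (i' : 'I_k.+3) (j' : 'I_k.+2)
    (s : singular R k.+2 X) :
  i' = bump i j :> nat -> j' = unbump j i :> nat ->
  face j (face i s) = face j' (face i' s).
Proof.
move=> ei ej; apply/continuousEP => x /=; congr (s _).
rewrite !simplex_map_comp; congr (simplex_map _ x); apply/funext => l.
by apply/val_inj; rewrite /= ei ej bumpC.
Qed.

Lemma singular_bd_bd k (c : chains k.+2) :
  singular_bd k (singular_bd k.+1 c) = 0.
Proof.
apply: (@malg_linear_ext _ _ _ (singular_bd k \o singular_bd k.+1) \0) => s.
rewrite /= [lin_ext (@bd_simplex k.+1) _]lin_extU /bd_simplex linear_sum /=.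
pose F (p : 'I_k.+3 * 'I_k.+2) : chains k :=
  (-1) ^+ (p.1 + p.2) *: mkmalgU (face p.2 (face p.1 s)) 1.
rewrite (eq_bigr (fun i => \sum_j F (i, j))); last first.
  move=> i _; rewrite linearZ /= lin_extU scaler_sumr; apply: eq_bigr => j _.
  by rewrite scalerA -exprD.
rewrite pair_big /= (bigID (fun p : 'I_k.+3 * 'I_k.+2 => (p.1 <= p.2)%N)) /=.
have [phi phiE] : exists phi : 'I_k.+3 * 'I_k.+2 -> 'I_k.+3 * 'I_k.+2, forall p,
    ((phi p).1 = bump p.1 p.2 :> nat) * ((phi p).2 = unbump p.2 p.1 :> nat).
  exists (fun p : 'I_k.+3 * 'I_k.+2 => (inord (bump p.1 p.2), inord (unbump p.2 p.1))) => -[i j] /=.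
  have := ltn_ord i; have := ltn_ord j; rewrite /bump /unbump => ? ?.
  by rewrite !inordK //; lia.
have phiK p : phi (phi p) = p.
  case: p => i j; rewrite [LHS]surjective_pairing.
  by congr pair; apply/val_inj; rewrite /= !phiE /= /bump /unbump; lia.
rewrite [X in _ + X](reindex_onto phi phi) /=; last by move=> p _; exact: phiK.
rewrite -[X in X + _]opprK; apply/eqP; rewrite addrC subr_eq0; apply/eqP.
rewrite -sumrN; apply: eq_big => [p|p].
  by rewrite phiK eqxx andbT !phiE /bump /unbump; lia.
rewrite phiK eqxx andbT => /negP pp.
rewrite /F /= -scaleNr (@face_face _ p.1 p.2 (phi p).1 (phi p).2) ?phiE //.
congr (_ *: _); rewrite -signr_odd -[in RHS]signr_odd.
have -> : odd (bump p.1 p.2 + unbump p.2 p.1) = ~~ odd (p.1 + p.2).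
  by rewrite /bump /unbump; lia.
by rewrite signrN.
Qed.

Definition singular_complex : chain_complex A :=
  @ChainComplex A (fun k => chains k) singular_bd singular_bd_bd.

End Singular.

Section Filtered.
Variables (R : realType) (A : comNzRingType) (X : filtered_space).

Notation chains k := (malg (singular R k X) A).

Definition filtered_simplex k (s : singular R k X) : Prop :=
  forall i : int, 0 <= i <= (fdim X)%:Z ->
    s @^-1` skel i = set0 \/
    exists2 m, (m <= k)%N & s @^-1` skel i = front_face R k m.

Definition perverse_degree k (s : singular R k X) (l : nat) : \bar R :=
  affdim [set val x | x in s @^-1` skel ((fdim X)%:Z - l%:Z)].

Lemma face_filtered k (i : 'I_k.+2) (s : singular R k.+1 X) :
  filtered_simplex s -> filtered_simplex (face i s).
Proof.
move=> fs j jX; rewrite /face comp_preimage.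
have [->|[m mk ->]] := fs j jX; first by left; rewrite preimage_set0.
have E (x : stdsimplex R k) : (simplex_map (lift i) @^-1` front_face R k.+1 m) x <->
    forall a : 'I_k.+1, (m < bump i a)%N -> (val x) 0 a = 0.
  split=> h a.
    move=> ma; have := h (lift i a) ma; rewrite /= mxE (big_pred1 a) // => b.
    by rewrite /= (inj_eq lift_inj).
  move=> ma /=; rewrite mxE big1 // => b /eqP ab; apply: h.
  by rewrite -[bump i b]/(val (lift i b)) ab.
have [mi|im] := ltnP m i.
  right; exists m; first by have := ltn_ord i; lia.
  apply/seteqP; split=> x.
    by move=> /E h a ma; apply: h; rewrite /bump; lia.
  by move=> h; apply/E => a ma; apply: h; move: ma; rewrite /bump; lia.
case: m mk im E => [|m] mk im E.
  left; apply/seteqP; split => // x /E h.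
  have : \sum_a (val x) 0 a = 1 by case: x {h} => x /=; rewrite inE => -[].
  rewrite big1 => [/esym/eqP|a _]; first by rewrite oner_eq0.
  by apply: h; rewrite /bump; lia.
right; exists m => //; apply/seteqP; split=> x.
  by move=> /E h a ma; apply: h; rewrite /bump; lia.
by move=> h; apply/E => a ma; apply: h; move: ma; rewrite /bump; lia.
Qed.

(* Faces of filtered simplices are filtered, so the span of the filtered
   simplices is already the subcomplex that they generate. *)
Definition filtered_chain k : {pred chains k} := fun c =>
  `[< exists r : seq (A * singular R k X),
        (forall p, p \in r -> filtered_simplex p.2) /\
        c = \sum_(p <- r) p.1 *: mkmalgU p.2 1 >].

Lemma filtered_chain_submod k : submod_closed (@filtered_chain k).
Proof.
split=> [|a c d /asboolP[r [fr ->]] /asboolP[t [ft ->]]].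
  by apply/asboolP; exists [::]; rewrite big_nil.
apply/asboolP; exists ([seq (a * p.1, p.2) | p <- r] ++ t); split=> [p|].
  by rewrite mem_cat => /orP[/mapP[q qr ->]|/ft//]; exact: (fr q qr).
rewrite big_cat big_map scaler_sumr /=; congr (_ + _).
by apply: eq_bigr => p _; rewrite scalerA.
Qed.

HB.instance Definition _ k :=
  GRing.isSubmodClosed.Build A (chains k) (@filtered_chain k)
    (@filtered_chain_submod k).

Definition filtered_chains k := {c : chains k | c \in @filtered_chain k}.

HB.instance Definition _ k := SubChoice.on (filtered_chains k).
HB.instance Definition _ k :=
  [SubChoice_isSubLmodule of filtered_chains k by <:].

Lemma filtered_simplex_chain k (s : singular R k X) :
  filtered_simplex s -> (mkmalgU s 1 : chains k) \in @filtered_chain k.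
Proof.
move=> fs; apply/asboolP; exists [:: (1, s)]; split=> [p|].
  by rewrite inE => /eqP ->.
by rewrite big_seq1 scale1r.
Qed.

Definition filtered_gen k (s : singular R k X) (fs : filtered_simplex s) :
  filtered_chains k :=
  exist (fun c => c \in @filtered_chain k) _ (filtered_simplex_chain fs).

Lemma singular_bd_filtered k (c : chains k.+1) :
  c \in @filtered_chain k.+1 -> singular_bd R A X k c \in @filtered_chain k.
Proof.
move=> /asboolP[r [fr ->]]; rewrite linear_sum big_seq.
apply: rpred_sum => p /fr fp; rewrite linearZ /= rpredZ // lin_extU.
apply: rpred_sum => i _; apply: rpredZ; apply: filtered_simplex_chain.
exact: face_filtered.
Qed.

Definition filtered_bd k (c : filtered_chains k.+1) : filtered_chains k :=
  exist (fun c => c \in @filtered_chain k) _ (singular_bd_filtered (valP c)).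

Lemma filtered_bd_linear k : linear (@filtered_bd k).
Proof. by move=> a c d; apply/val_inj; rewrite /= linearP. Qed.

HB.instance Definition _ k :=
  GRing.isLinear.Build A (filtered_chains k.+1) (filtered_chains k) *:%R
    (@filtered_bd k) (@filtered_bd_linear k).

Lemma filtered_bd_bd k (c : filtered_chains k.+2) :
  filtered_bd (filtered_bd c) = 0.
Proof. by apply/val_inj; exact: singular_bd_bd. Qed.

Definition filtered_complex : chain_complex A :=
  @ChainComplex A (fun k => filtered_chains k) (fun k => @filtered_bd k)
    filtered_bd_bd.

End Filtered.

Definition push (R : realType) (X Y : topologicalType)
    (f : continuousType X Y) k (s : singular R k X) : singular R k Y :=
  f \o s.

(* F is the linear extension of s |-> f \o s. *)
Definition extends_push (R : realType) (A : comNzRingType)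
    (X Y : filtered_space) (f : continuousType X Y)
    (F : chain_map (filtered_complex R A X) (filtered_complex R A Y)) : Prop :=
  forall k (s : singular R k X) (hs : filtered_simplex s)
    (hfs : filtered_simplex (push f s)),
    F k (filtered_gen A hs) = filtered_gen A hfs.

(* Main.v *)
(* Pointwise, f^-1(Y_(m-l)) is contained in X_(n-l), because f does not increase
   the codimension of strata; this gives the bound on perverse degrees.  For the
   filtered condition, s^-1(X_i) \ s^-1(X_(i-1)) is a difference of front faces,
   so s maps it into one stratum of X and f s into one stratum of Y.  As Y_j is
   closed, (f s)^-1(Y_j) thus contains the whole face s^-1(X_i) as soon as it
   meets this difference: it is a union of front faces, hence a front face. *)
Require Import Defs.
From HB Require Import structures.
From mathcomp Require Import all_boot all_order all_algebra finmap.
From mathcomp Require Import boolp classical_sets functions reals.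
From mathcomp Require Import constructive_ereal ereal topology normedtype.
From mathcomp Require Import -(notations) monalg.

Set Implicit Arguments.
Unset Strict Implicit.
Unset Printing Implicit Defensive.

Import Order.TTheory GRing.Theory Num.Theory.
Import numFieldNormedType.Exports.
Local Open Scope classical_set_scope.
Local Open Scope ring_scope.

(** * Levels of points, and the effect of a stratified map on them *)

Lemma skel_le (X : filtered_space) (i j : int) : i <= j -> @skel X i `<=` skel j.
Proof.
move=> ij; rewrite (_ : j = i + absz (j - i)); last first.
  by rewrite gez0_abs ?subr_ge0 // addrCA subrr addr0.
elim: absz => [|n IHn]; first by rewrite addr0.
by rewrite -addn1 PoszD addrA; apply: subset_trans IHn _; exact: skel_subset.
Qed.

(** The level is the least natural [n] with [x] in [skel n]. One exists because [skel (fdim X)] is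
    everything. For [n = 0] the skeleton below is empty. *)
Lemma exists_level (X : filtered_space) (x : X) :
  exists2 i : int, 0 <= i <= (fdim X)%:Z & (skel i `\` skel (i - 1)) x.
Proof.
have ex : exists n : nat, `[< skel n%:Z x >].
  by exists (fdim X); apply/asboolP; rewrite skel_top.
case: (ex_minnP ex) => n /asboolP nx nmin; exists n%:Z.
  by rewrite le0z_nat lez_nat nmin //; apply/asboolP; rewrite skel_top.
split=> //; case: n nx nmin => [|n] _ nmin; first by rewrite skel_neg.
rewrite -addn1 PoszD addrK => nx; have := nmin n; rewrite ltnn => /(_ _)/negP.
by apply=> //; apply/asboolP.
Qed.

Lemma stratum_sub (X : filtered_space) i (S : set X) :
  stratum i S -> S `<=` skel i `\` skel (i - 1).
Proof. by case=> x _ ->; exact: connected_component_sub. Qed.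

Lemma stratified_map_level (X Y : filtered_space) (f : continuousType X Y) :
  stratified_map f -> forall (i j : int) (B : set X) x,
  connected B -> B `<=` skel i `\` skel (i - 1) -> B x -> skel j (f x) ->
  (fdim Y)%:Z - j <= (fdim X)%:Z - i /\ f @` B `<=` skel j.
Proof.
move=> hf i j B x cB Bi Bx jfx.
have [|j' [Sf [strS fS dS]]] :=
    hf i (connected_component (skel i `\` skel (i - 1)) x).
  by exists x => //; exact: Bi.
have BS : B `<=` connected_component (skel i `\` skel (i - 1)) x.
  exact: connected_component_max.
have Sfx : Sf (f x) by apply: fS; exists x => //; exact: BS.
(* If [j < j'], then [f x] would lie in [skel (j' - 1)], which [Sf] avoids. *)
have j'j : j' <= j.
  rewrite leNgt; apply/negP => jj'; have [_] := stratum_sub strS Sfx; apply.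
  by apply: skel_le jfx; rewrite lerBrDr lezD1.
split; first by apply: le_trans dS; rewrite lerB.
move=> _ [z Bz <-]; apply: (skel_le j'j).
by have [] := @stratum_sub _ _ _ strS (f z) (fS _ (ex_intro2 _ _ z (BS _ Bz) erefl)).
Qed.

(** The previous lemma for the connected set [[set x]], with [x] of level [i], gives
    [l <= fdim X - i]. *)
Lemma stratified_map_codim (X Y : filtered_space) (f : continuousType X Y) l :
  stratified_map f ->
  f @^-1` skel ((fdim Y)%:Z - l) `<=` skel ((fdim X)%:Z - l).
Proof.
move=> hf x jfx; have [i _ ix] := exists_level x.
have xi : [set x] `<=` skel i `\` skel (i - 1) by move=> _ ->.
have [le_li _] := stratified_map_level hf (@connected1 _ x) xi erefl jfx.
by case: ix => ix _; apply: skel_le ix; move: le_li; rewrite subKr !lerBrDr addrC.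
Qed.

(** * Segments and front faces in the simplex, and preimages under pushed simplices *)

Section Segment.
Variables (R : realType) (k : nat).
Implicit Types x y : stdsimplex R k.

Let clamp (t : R) := Num.max 0 (Num.min t 1).

Lemma segment_subproof x y t :
  (1 - clamp t) *: val y + clamp t *: val x \in stdsimplex R k.
Proof.
have c0 : 0 <= clamp t by rewrite le_max lexx.
have c1 : clamp t <= 1 by rewrite ge_max ler01 ge_min lexx orbT.
case: x y => [x xs] [y ys] /=; move: xs ys; rewrite !inE /= => -[x0 x1] [y0 y1].
split=> [i|]; first by rewrite !mxE addr_ge0 // mulr_ge0 // subr_ge0.
under eq_bigr do rewrite !mxE.
by rewrite big_split /= -!mulr_sumr x1 y1 !mulr1 subrK.
Qed.

(* The parameter is clamped to [0, 1] so that the segment from [y] to [x] is a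
   continuous function on the whole line. *)
Definition segment x y t : stdsimplex R k :=
  exist (fun z => z \in stdsimplex R k) _ (segment_subproof x y t).

Lemma segmentE x y t i : 0 <= t <= 1 ->
  val (segment x y t) 0 i = (1 - t) * val y 0 i + t * val x 0 i.
Proof.
by case/andP=> t0 t1; rewrite !mxE /clamp (min_idPl t1) (max_idPr t0).
Qed.

Lemma segment0 x y : segment x y 0 = y.
Proof.
by apply/val_inj/rowP => i; rewrite segmentE ?lexx ?ler01// subr0 mul1r mul0r addr0.
Qed.

Lemma segment1 x y : segment x y 1 = x.
Proof.
by apply/val_inj/rowP => i; rewrite segmentE ?lexx ?ler01// subrr mul0r mul1r add0r.
Qed.

Lemma clamp_continuous : continuous clamp.
Proof.
move=> t; apply: (@continuous_max R R (cst 0) (id \min cst 1) t).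
  exact: cst_continuous.
by apply: (@continuous_min _ _ id (cst 1)); [exact: cvg_id|exact: cst_continuous].
Qed.

Lemma segment_continuous x y : continuous (segment x y).
Proof.
apply: continuous_comp_initial => t /=.
apply: cvgD; apply: cvgZr_tmp; last exact: clamp_continuous.
by apply: (@cvgB _ R^o); [exact: cvg_cst|exact: clamp_continuous].
Qed.

End Segment.

Section FrontFaces.
Variables (R : realType) (k : nat).

Lemma front_face_le m n :
  (m <= n)%N -> front_face R k m `<=` front_face R k n.
Proof. by move=> mn x xm i ni; apply: xm; exact: leq_ltn_trans ni. Qed.

Lemma front_face_segment m (x y : stdsimplex R k) t : 0 < t <= 1 ->
  front_face R k m x -> front_face R k m y ->
  front_face R k m (segment x y t).
Proof.
case/andP=> t0 t1 xm ym i mi.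
by rewrite segmentE ?(ltW t0) // xm // ym // !mulr0 addr0.
Qed.

(** A vanishing sum of nonnegative terms has vanishing terms, and the weight [t] of [x] is positive.
    This keeps a segment out of a front face that misses its end [x]. *)
Lemma front_face_segment_inv m (x y : stdsimplex R k) t : 0 < t <= 1 ->
  front_face R k m (segment x y t) -> front_face R k m x.
Proof.
case/andP=> t0 t1 sm i mi; have t01 : 0 <= t <= 1 by rewrite ltW.
have ge0 (z : stdsimplex R k) : 0 <= val z 0 i.
  by case: z => z /=; rewrite inE => -[].
have /eqP := sm i mi; rewrite segmentE //.
rewrite paddr_eq0 ?mulr_ge0 ?subr_ge0 ?(ltW t0) // => /andP[_].
by rewrite mulf_eq0 gt_eqF //= => /eqP.
Qed.

(** Front faces are nested and finitely many, so the largest one inside [Q] contains all the others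
    and equals [Q]. *)
Lemma union_front_faces (Q : set (stdsimplex R k)) :
  (forall x, Q x -> exists2 m, (m <= k)%N &
     front_face R k m x /\ front_face R k m `<=` Q) ->
  Q = set0 \/ exists2 m, (m <= k)%N & Q = front_face R k m.
Proof.
move=> QF; have [->|/set0P[x0 /QF[m0 m0k [_ m0Q]]]] := eqVneq Q set0; first by left.
right; pose P m := (m <= k)%N && `[< front_face R k m `<=` Q >].
have exP : exists m, P m by exists m0; rewrite /P m0k; apply/asboolP.
have leP m : P m -> (m <= k)%N by case/andP.
case: (ex_maxnP exP leP) => m /andP[mk /asboolP mQ] mmax; exists m => //.
apply/seteqP; split=> // x /QF[n nk [xn nQ]]; apply: front_face_le xn.
by apply: mmax; rewrite /P nk; apply/asboolP.
Qed.

End FrontFaces.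

(* For [x] in the preimage with [s x] in X_i \ X_(i-1) and [y] in the face
   s^-1(X_i), the segment from [x] to [y] deprived of [y] is mapped into the
   stratum of [s x]; since Y_j is closed, [y] is in the preimage too. *)
Lemma push_preimage_front_face (R : realType) (X Y : filtered_space)
    (f : continuousType X Y) k (s : singular R k X) j x :
  stratified_map f -> filtered_simplex s -> (push f s @^-1` skel j) x ->
  exists2 m, (m <= k)%N &
    front_face R k m x /\ front_face R k m `<=` push f s @^-1` skel j.
Proof.
move=> hf fs jx; have [i iX [ix nix]] := exists_level (s x).
have [s0|[m mk sm]] := fs i iX; first by have : (s @^-1` skel i) x by []; rewrite s0.
exists m => //; rewrite -sm; split=> // y iy.
(* Parameter 0 is the point [y], where the path may drop into [skel (i - 1)]; it is recovered at the
   end as a limit. *)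
pose B := (s \o segment x y) @` [set` `]0, 1]%R].
have sc : continuous (s \o segment x y).
  by move=> t; apply: continuous_comp; [exact: segment_continuous|exact: cts_fun].
have cB : connected B.
  apply: connected_continuous_connected; last exact: continuous_subspaceT.
  exact/connected_intervalP/interval_is_interval.
have Bi : B `<=` skel i `\` skel (i - 1).
  move=> _ [t /= t01 <-]; rewrite in_itv /= in t01; split.
    rewrite -[skel i _]/((s @^-1` skel i) _) sm.
    by apply: front_face_segment => //; rewrite -sm.
  (* For [i = 0] the index [i - 1] is outside the range covered by [filtered_simplex]. *)
  have [i0|i0] := ltP (i - 1) 0; first by rewrite skel_neg.
  have [|s0|[m' m'k sm']] := fs (i - 1).
  - by case/andP: iX => _ iX; rewrite i0 (le_trans _ iX) // gerBl.
  - by move=> h; have : (s @^-1` skel (i - 1)) (segment x y t) by []; rewrite s0.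
  - rewrite -[skel (i - 1) _]/((s @^-1` skel (i - 1)) _) sm'.
    by move=> /(front_face_segment_inv t01); rewrite -sm'.
have Bx : B (s x).
  by exists 1; rewrite /= ?in_itv/= ?ltr01 ?lexx // segment1.
have [_ fBj] := stratified_map_level hf cB Bi Bx jx.
have gc : continuous (f \o (s \o segment x y)).
  by move=> t; apply: continuous_comp; [exact: sc|exact: cts_fun].
suff : skel j ((f \o (s \o segment x y)) 0) by rewrite /= segment0.
apply: (closed_cvg _ (@skel_closed Y j) _ _ (cvg_at_right_filter (gc 0))).
near=> t; apply: fBj; exists (s (segment x y t)) => //; exists t => //=.
by rewrite in_itv /=; apply/andP; split; near: t;
  [exact: nbhs_right_gt|exact/nbhs_right_le/ltr01].
Unshelve. all: by end_near. Qed.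

Lemma push_filtered (R : realType) (X Y : filtered_space)
    (f : continuousType X Y) k (s : singular R k X) :
  stratified_map f -> filtered_simplex s -> filtered_simplex (push f s).
Proof.
by move=> hf fs j _; apply: union_front_faces => x; exact: push_preimage_front_face.
Qed.

Lemma affdim_le (R : realType) d (A B : set 'rV[R]_d) :
  A `<=` B -> (affdim A <= affdim B)%E.
Proof.
move=> AB; apply: ereal_sup_le => _ [q [p [Ap fp]] <-].
by exists q => //; exists p; split=> // i; exact: AB.
Qed.

(** * The induced chain map and its uniqueness *)

Section PushChain.
Variables (R : realType) (A : comNzRingType) (X Y : filtered_space).
Variable f : continuousType X Y.
Hypothesis hf : stratified_map f.

(** Defined on all singular chains, which are free on the simplices, so that compatibility with the
    boundary can be checked on simplices before restricting to filtered chains. *)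
Definition singular_push k :
    {linear malg (singular R k X) A -> malg (singular R k Y) A} :=
  lin_ext (fun s => mkmalgU (push f s) 1).

Lemma singular_pushU k (s : singular R k X) :
  singular_push k (mkmalgU s 1) = mkmalgU (push f s) 1.
Proof. exact: lin_extU. Qed.

Lemma push_face k (i : 'I_k.+2) (s : singular R k.+1 X) :
  face i (push f s) = push f (face i s).
Proof. exact/continuousEP. Qed.

Lemma singular_push_bd k (c : malg (singular R k.+1 X) A) :
  singular_push k (singular_bd R A X k c) =
  singular_bd R A Y k (singular_push k.+1 c).
Proof.
apply: (@malg_linear_ext _ _ _ (singular_push k \o singular_bd R A X k)
  (singular_bd R A Y k \o singular_push k.+1)) => s /=.
rewrite !lin_extU linear_sum; apply: eq_bigr => i _.
by rewrite linearZ /= lin_extU push_face.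
Qed.

Lemma singular_push_filtered k (c : malg (singular R k X) A) :
  c \in @filtered_chain R A X k -> singular_push k c \in @filtered_chain R A Y k.
Proof.
move=> /asboolP[r [fr ->]]; rewrite linear_sum big_seq.
apply: rpred_sum => p /fr fp; rewrite linearZ rpredZ //.
rewrite [X in X \in _]singular_pushU.
exact/filtered_simplex_chain/push_filtered.
Qed.

Definition filtered_push k (c : filtered_chains R A X k) :
    filtered_chains R A Y k :=
  exist (fun c => c \in @filtered_chain R A Y k) _ (singular_push_filtered (valP c)).

Lemma filtered_push_linear k : linear (@filtered_push k).
Proof. by move=> a c d; apply/val_inj; rewrite /= linearP. Qed.

HB.instance Definition _ k :=
  GRing.isLinear.Build A (filtered_chains R A X k) (filtered_chains R A Y k) *:%R
    (@filtered_push k) (@filtered_push_linear k).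

Lemma filtered_push_bd k (c : filtered_chains R A X k.+1) :
  filtered_push (filtered_bd c) = filtered_bd (filtered_push c).
Proof. by apply/val_inj; exact: singular_push_bd. Qed.

Definition filtered_push_map :
    chain_map (filtered_complex R A X) (filtered_complex R A Y) :=
  @ChainMap A (filtered_complex R A X) (filtered_complex R A Y)
    (fun k => @filtered_push k) filtered_push_bd.

Lemma filtered_push_map_gen : extends_push f filtered_push_map.
Proof. by move=> k s hs hfs; apply/val_inj; exact: singular_pushU. Qed.

End PushChain.

(** Induction on an expression of [c] as a combination of filtered simplices; this yields uniqueness
    of the chain map. *)
Lemma filtered_gen_span (R : realType) (A : comNzRingType) (X : filtered_space)
    (V : lmodType A) k (F G : {linear filtered_chains R A X k -> V}) :
  (forall s (hs : filtered_simplex s),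
     F (filtered_gen A hs) = G (filtered_gen A hs)) -> F =1 G.
Proof.
move=> FG c; have /asboolP[r [fr cE]] := valP c.
elim: r fr c cE => [_ c|p r IHr fr c].
  rewrite big_nil => c0; have -> : c = 0 by exact/val_inj.
  by rewrite !linear0.
have fp : filtered_simplex p.2 by apply: fr; rewrite mem_head.
rewrite big_cons => cE.
(* The leading term is split off inside the submodule; the remainder is a filtered chain expressed
   by [r]. *)
rewrite -(subrK (p.1 *: filtered_gen A fp) c).
rewrite [LHS]linearD [RHS]linearD !linearZ /= FG; congr (_ + _); apply: IHr.
  by move=> q qr; apply: fr; rewrite inE qr orbT.
by rewrite /= cE scalerN addrC addKr.
Qed.

(** That composition with [f] defines a chain map is rendered as existence and uniqueness of a chain
    map with the prescribed values on generators. *)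
Theorem theorem6 (R : realType) (A : comNzRingType) (X Y : filtered_space)
    (hX : stratified X) (hY : stratified Y)
    (f : continuousType X Y) (hf : stratified_map f) :
  [/\ forall k (s : singular R k X),
        filtered_simplex s -> filtered_simplex (push f s),
      exists F : chain_map (filtered_complex R A X) (filtered_complex R A Y),
        extends_push f F /\
        forall G : chain_map (filtered_complex R A X) (filtered_complex R A Y),
          extends_push f G ->
          forall k (c : filtered_complex R A X k), G k c = F k c
    & forall k (s : singular R k X) (l : nat), filtered_simplex s ->
        (perverse_degree (push f s) l <= perverse_degree s l)%E ].
Proof.
split=> [k s|| k s l _].
- exact: push_filtered.
- exists (filtered_push_map R A hf); split; first exact: filtered_push_map_gen.
  move=> G hG k; apply: filtered_gen_span => s hs.
  have hfs := push_filtered hf hs.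
  by rewrite (hG k s hs hfs) (@filtered_push_map_gen R A _ _ _ hf k s hs hfs).
- apply: affdim_le => _ [x xl <-]; exists x => //.
  exact: (stratified_map_codim hf).
Qed.
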